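(* Let $d\ge3$ and $0<a<b<d$ be integers with $\mathrm{GCD}(a,b,d)=1$, let $X_d$ be the $GT$-surface with group $\Lambda=\langle\mathrm{diag}(1,e^a,e^b)\rangle$, and let $\theta(a,b,d):=(a,d)+(\lambda,d')+(\lambda-(a,d),d')$, where $d'$ and $\lambda$ are defined in the context. Then: (i) for all $t\ge0$, $HF(X_d,t)=\frac{d}{2}t^2+\frac12\theta(a,b,d)\,t+1$; (ii) the Hilbert series of $X_d$ is $$HS(X_d,z)=\frac{\frac{d-\theta(a,b,d)+2}{2}z^2+\frac{d+\theta(a,b,d)-4}{2}z+1}{(1-z)^3}.$$
   Context: $k$ is an algebraically closed field of characteristic zero, $R=k[x_0,x_1,x_2]$, $e\in k$ is a primitive $d$th root of unity, and $\Lambda\subset GL(3,k)$ is the cyclic group of order $d$ generated by $\mathrm{diag}(1,e^a,e^b)$, acting on $R$ by $x_0\mapsto x_0$, $x_1\mapsto e^ax_1$, $x_2\mapsto e^bx_2$. Let $m_1,\ldots,m_{\mu_d}$ be all the monomials of degree $d$ in $R$ which are invariants of $\Lambda$. The $GT$-surface $X_d\subset\mathbb{P}^{\mu_d-1}$ with group $\Lambda$ is the image of the morphism $\mathbb{P}^2\to\mathbb{P}^{\mu_d-1}$ defined by $(m_1,\ldots,m_{\mu_d})$. With $S=k[w_1,\ldots,w_{\mu_d}]$ and $I(X_d)\subset S$ the homogeneous ideal of $X_d$, put $HF(X_d,t)=\dim_k(S/I(X_d))_t$ and $HS(X_d,z)=\sum_{t\ge0}HF(X_d,t)z^t$. $(u,v)$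 denotes the greatest common divisor of the integers $u,v$ (with $(0,v)=v$ for $v>0$, and signs ignored). Put $a'=\frac{a}{(a,d)}$ and $d'=\frac{d}{(a,d)}$; $\lambda$ and $\mu$ are the uniquely determined integers such that $0<\lambda\le d'$ and $b=\lambda a'+\mu d'$. *)

(* Defs.v *)
From HB Require Import structures.
From mathcomp Require Import all_boot all_order all_algebra.
From mathcomp Require Import mpoly.
From mathcomp Require Import boolp classical_sets.

Set Implicit Arguments.
Unset Strict Implicit.
Unset Printing Implicit Defensive.

Import GRing.Theory.
Local Open Scope ring_scope.

Section LinearAlgebra.
Variables (k : fieldType) (L : lmodType k) (V W : L -> Prop).

(* For subspaces V and W of L: the classes of v_0, ..., v_(n-1) form a basis
   of V / (V :&: W), that is, of the image of V in the quotient L / W. *)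
Definition quot_basis (n : nat) (v : 'I_n -> L) : Prop :=
  [/\ forall i, V (v i),
      forall c : 'I_n -> k, W (\sum_i c i *: v i) -> forall i, c i = 0
    & forall x, V x -> exists c : 'I_n -> k, W (x - \sum_i c i *: v i)].

(* The default value 0 is returned only in the infinite-dimensional case. *)
Definition quot_dim : nat :=
  xget 0%N [set n : nat | exists v : 'I_n -> L, quot_basis v].

End LinearAlgebra.

Section ProjectiveSets.
Variables (k : fieldType) (n : nat).

(* Points of the (n-1)-dimensional projective space are given by their
   homogeneous coordinates: nonzero vectors, up to proportionality. *)
Definition hcoord (x : 'I_n -> k) : Prop := exists i, x i != 0.

Definition same_point (x y : 'I_n -> k) : Prop :=
  exists2 c : k, c != 0 & forall i, x i = c * y i.

Definition vanishes_on (X : ('I_n -> k) -> Prop) (f : {mpoly k[n]}) : Prop :=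
  forall x, X x -> f.@[x] = 0.

Definition gen_ideal (G : {mpoly k[n]} -> Prop) (p : {mpoly k[n]}) : Prop :=
  exists (r : nat) (g f : 'I_r -> {mpoly k[n]}),
    (forall i, G (f i)) /\ p = \sum_i g i * f i.

Definition homog_ideal (X : ('I_n -> k) -> Prop) : {mpoly k[n]} -> Prop :=
  gen_ideal (fun f => (exists t : nat, f \is t.-homog) /\ vanishes_on X f).

(* The t-th graded piece of S / I(X) is the image of S_t in S / I(X). *)
Definition hilbert_fun (X : ('I_n -> k) -> Prop) (t : nat) : nat :=
  quot_dim (fun f : {mpoly k[n]} => f \is t.-homog) (homog_ideal X).

End ProjectiveSets.

(* A formal power series over F is given by its sequence of coefficients. *)
Section PowerSeries.
Variable F : fieldType.

Definition fps_mul (f g : nat -> F) : nat -> F :=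
  fun n => \sum_(i < n.+1) f i * g (n - i)%N.

Definition fps_of_poly (p : {poly F}) : nat -> F := fun n => p`_n.

(* f = p / q in F[[z]]: q is a unit of F[[z]] and q f = p. *)
Definition fps_is_frac (f : nat -> F) (p q : {poly F}) : Prop :=
  q`_0 != 0 /\ fps_mul (fps_of_poly q) f =1 fps_of_poly p.

End PowerSeries.

Definition hilbert_series (k : fieldType) (n : nat)
    (X : ('I_n -> k) -> Prop) : nat -> rat :=
  fun t => (hilbert_fun X t)%:R.

Section GTSurface.
Variables (k : fieldType) (e : k) (a b d : nat).

Definition Lambda_gen : 'M[k]_3 :=
  diag_mx (\row_(i < 3) [:: 1; e ^+ a; e ^+ b]`_i).

(* When e ^+ d = 1, the powers of exponent less than d exhaust the group
   generated by Lambda_gen. *)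
Definition Lambda : seq 'M[k]_3 := [seq Lambda_gen ^+ j | j <- iota 0 d].

Definition lin_subst (g : 'M[k]_3) (p : {mpoly k[3]}) : {mpoly k[3]} :=
  p \mPo [tuple \sum_(j < 3) g i j *: 'X_j | i < 3].

Definition Lambda_invariant (p : {mpoly k[3]}) : bool :=
  all (fun g => lin_subst g p == p) Lambda.

Definition inv_monomials : seq 'X_{1..3} :=
  [seq m <- [seq bmnm m | m <- enum {: 'X_{1..3 < d.+1}}]
     | (mdeg m == d) && Lambda_invariant 'X_[m]].

Definition GT_mu : nat := size inv_monomials.

Definition GT_map (x : 'I_3 -> k) : 'I_GT_mu -> k :=
  fun i => 'X_[tnth (in_tuple inv_monomials) i].@[x].

Definition GT_surface (y : 'I_GT_mu -> k) : Prop :=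
  hcoord y /\ exists2 x : 'I_3 -> k, hcoord x & same_point y (GT_map x).

End GTSurface.

Arguments GT_surface {k} e a b d y.

Definition theta (a d : nat) (lam : int) : int :=
  gcdz a d + gcdz lam (d %/ gcdn a d)%N
    + gcdz (lam - gcdz a d) (d %/ gcdn a d)%N.

(* Main.v *)
From HB Require Import structures.
Require Import Defs.
From mathcomp Require Import all_boot all_order all_algebra.
From mathcomp Require Import mpoly.
From mathcomp Require Import boolp classical_sets.
From mathcomp Require Import zify ring lra.

Import GRing.Theory.
Set Implicit Arguments.
Unset Strict Implicit.

(** Substituting the invariant monomials for the variables w_i sends a monomial
    of degree t in the w_i to a Lambda-invariant monomial of degree td in
    x_0, x_1, x_2, and a form f of degree t lies in I(X_d) exactly when its
    image is 0: the image vanishes at every point of the torus, so it is zero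
    because the field is infinite ([mpoly_vanish_eq0]).  Hence HF(X_d, t) is
    the number of products of t invariant monomials of degree d.

    These products are all the invariant monomials of degree td: the lattice
    triangle of the exponents is normal.  By induction it is enough to split
    off one invariant monomial of degree d ([triangle_split]).  A variable of
    exponent at least d gives its d-th power; otherwise t <= 2, the case t = 1
    is clear, and for t = 2 the exponent vector is P = (i, j, l) with
    coordinates below d and sum 2d.  The residues modulo d
    of kP have sum 2d for k = 1 and sum 0 for k = d, so the sum drops from 2d
    to at most d between two consecutive multiples kP and (k+1)P.  Adding P
    then carries in all three coordinates, so that d minus the residues of kP
    is an invariant exponent vector of degree d below P
    ([exists_carry_multiple]).

    It remains to count the (j, l) with j + l <= td and d | aj + bl.  In the
    square [0, td)^2 there are t * td such points, because gcd(a, b, d) = 1.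
    The half-turn about the centre of the square exchanges the two open halves
    cut out by the diagonal, and the points on the sides and on the diagonal
    are counted by linear congruences in one variable, whence the count
    (d t^2 + B t + 2) / 2 with B = (a,d) + (b,d) + (b-a,d)
    ([card_triangle_points]).  Finally B = theta(a,b,d), since (a,d) is prime
    to b, and the Hilbert series is the generating function of a quadratic
    polynomial. *)

(** * Splitting a point of the dilated triangle *)

Local Open Scope nat_scope.

Lemma modn_add_carry d x y : 0 < d ->
  (x + y) %% d + (d <= x %% d + y %% d) * d = x %% d + y %% d.
Proof.
move=> d_gt0; have := ltn_pmod x d_gt0; have := ltn_pmod y d_gt0.
rewrite -modnDm; move: (x %% d) (y %% d) => u v ltv ltu.
case: leqP => h; last by rewrite modn_small ?addn0.
have -> : u + v = (u + v - d) + d by lia.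
rewrite modnDr modn_small; lia.
Qed.

(** The sum of the residues of k (i, j, l) is a multiple of d below 3d.  At the
    last k before it first drops to at most d it is 2d, and the next multiple
    adds 2d and must lose 3d: every coordinate carries. *)
Lemma exists_carry_multiple d i j l :
    0 < d -> i < d -> j < d -> l < d -> i + j + l = 2 * d ->
  exists k, [/\ d <= (k * i) %% d + i, d <= (k * j) %% d + j,
    d <= (k * l) %% d + l & (k * i) %% d + (k * j) %% d + (k * l) %% d = 2 * d].
Proof.
move=> d_gt0 lti ltj ltl sum_ijl.
pose g k := (k * i) %% d + (k * j) %% d + (k * l) %% d.
have dvd_g k : d %| g k.
  rewrite /dvdn /g modnDmr -addnA modnDml addnCA modnDml addnCA addnA.
  by rewrite -!mulnDr sum_ijl mulnA modnMl.
have [] := ex_minnP (_ : exists k, g k.+1 <= d).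
  by exists d.-1; rewrite /g prednK // !modnMr.
case=> [|k] gk min_k.
  by move: gk; rewrite /g !mul1n !modn_small //; lia.
have gk_gt : d < g k.+1 by rewrite ltnNge; apply/negP=> /min_k; rewrite ltnn.
have gk1 : g k.+1 = 2 * d.
  have gk_lt : g k.+1 < 3 * d.
    rewrite /g; have := ltn_pmod (k.+1 * i) d_gt0.
    have := ltn_pmod (k.+1 * j) d_gt0; have := ltn_pmod (k.+1 * l) d_gt0; lia.
  case/dvdnP: (dvd_g k.+1) => q gq; move: gk_gt gk_lt; rewrite gq ltn_mul2r.
  by rewrite -{1}[d]mul1n !ltn_mul2r d_gt0 /=; case: q {gq} => [|[|[|q]]].
have carry x : x < d ->
    (k.+2 * x) %% d + (d <= (k.+1 * x) %% d + x) * d = (k.+1 * x) %% d + x.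
  move=> ltx; have := modn_add_carry (k.+1 * x) x d_gt0.
  by rewrite (modn_small ltx) -mulSnr.
exists k.+1; move: gk gk1 (carry i lti) (carry j ltj) (carry l ltl); rewrite /g.
by do 3 (case: leqP => ?); split; lia.
Qed.

Lemma dvdn_mulDr_modn d a b k j l :
    0 < d -> d %| a * j + b * l ->
  d %| a * (d - (k * j) %% d) + b * (d - (k * l) %% d).
Proof.
move=> d_gt0 dvd.
rewrite -(@dvdn_addl (a * ((k * j) %% d) + b * ((k * l) %% d)) d).
  rewrite addnACA -!mulnDr !subnK ?(ltnW (ltn_pmod _ d_gt0)) //.
  by rewrite -mulnDl dvdn_mull.
rewrite /dvdn -modnDm !modnMmr modnDm (mulnCA a) (mulnCA b) -mulnDr.
by rewrite -/(dvdn _ _) dvdn_mull.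
Qed.

(** The exponent vector of an invariant monomial of degree d that divides a
    given invariant monomial; the quotient is invariant again, so that this is
    the inductive step of the normality of the triangle. *)
Lemma triangle_split d a b t i j l :
    0 < d -> i + j + l = t.+1 * d -> d %| a * j + b * l ->
  exists i' j' l', [/\ [/\ i' <= i, j' <= j & l' <= l],
    i' + j' + l' = d & d %| a * j' + b * l'].
Proof.
move=> d_gt0 sum_ijl dvd.
have [le_di|lti] := leqP d i.
  by exists d, 0, 0; split; rewrite ?muln0 ?addn0 ?dvdn0.
have [le_dj|ltj] := leqP d j.
  by exists 0, d, 0; split; rewrite ?muln0 ?addn0 ?dvdn_mull.
have [le_dl|ltl] := leqP d l.
  by exists 0, 0, d; split; rewrite ?muln0 ?dvdn_mull.
(* All exponents are below d now, so the degree is d or 2d. *)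
case: t sum_ijl => [|[|t]] sum_ijl; last first.
- by move: sum_ijl; rewrite !mulSn; move: (t * d); lia.
- have [k [ci cj cl sum_k]] := exists_carry_multiple d_gt0 lti ltj ltl sum_ijl.
  exists (d - (k * i) %% d), (d - (k * j) %% d), (d - (k * l) %% d).
  split; last exact: dvdn_mulDr_modn.
    by split; lia.
  have := ltn_pmod (k * i) d_gt0.
  by have := ltn_pmod (k * j) d_gt0; have := ltn_pmod (k * l) d_gt0; lia.
- by exists i, j, l; split; rewrite // sum_ijl mul1n.
Qed.

(** * Counting the points of the dilated triangle *)

Lemma sum_periodic (F : nat -> nat) p n :
    (forall i, F (i + p) = F i) ->
  \sum_(0 <= i < n * p) F i = n * \sum_(0 <= i < p) F i.
Proof.
move=> perF; elim: n => [|n IHn]; first by rewrite !mul0n big_geq.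
rewrite !mulSn addnC (@big_cat_nat _ _ _ (n * p)) ?leq_addr //= IHn addnC.
congr (_ + _); rewrite -{1}[n * p]add0n big_addn addKn.
apply: eq_bigr => i _; elim: n {IHn} => [|n IHn]; first by rewrite mul0n addn0.
by rewrite mulSn addnCA addnC perF.
Qed.

(** The affine map with a coprime slope permutes the residues modulo p. *)
Lemma count_coprime_congruence p u c :
  0 < p -> coprime u p -> \sum_(0 <= j < p) (p %| u * j + c) = 1.
Proof.
case: p => // p _ cop_up; rewrite big_mkord.
pose f (j : 'I_p.+1) : 'I_p.+1 := inord ((u * j + c) %% p.+1).
have f_inj : injective f.
  move=> i j /(congr1 (@nat_of_ord _)); rewrite !inordK ?ltn_pmod // => /eqP.
  rewrite eqn_modDr => eqm; apply/val_inj.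
  wlog le_ij : i j eqm / i <= j => [H|].
    by case/orP: (leq_total i j) => [/H|/H/esym]; apply=> //; rewrite eq_sym.
  move: eqm; rewrite eq_sym eqn_mod_dvd ?leq_mul2l ?le_ij ?orbT //.
  rewrite -mulnBr Gauss_dvdr 1?coprime_sym // => dvd_ji.
  apply/eqP; rewrite eqn_leq le_ij /= -subn_eq0.
  rewrite -[X in X == 0](@modn_small _ p.+1) // ltnS.
  by rewrite (leq_trans (leq_subr _ _)) // -ltnS.
transitivity (\sum_(i < p.+1) (i == ord0)).
  rewrite [RHS](reindex_inj f_inj); apply: eq_bigr => j _.
  by rewrite -(inj_eq val_inj) /= inordK ?ltn_pmod.
by rewrite (bigD1 ord0) //= big1 // => i /negbTE->.
Qed.

Lemma count_congruence d u c n : 0 < d ->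
  \sum_(0 <= j < n * d) (d %| u * j + c) = (gcdn u d %| c) * (n * gcdn u d).
Proof.
move=> d_gt0; set g := gcdn u d.
have g_gt0 : 0 < g by rewrite gcdn_gt0 d_gt0 orbT.
have /dvdnP[u' u'E] : g %| u by exact: dvdn_gcdl.
have /dvdnP[d' d'E] : g %| d by exact: dvdn_gcdr.
have cop : coprime u' d'.
  rewrite /coprime -(eqn_pmul2r g_gt0) mul1n muln_gcdl -u'E -d'E; exact/eqP.
have d'_gt0 : 0 < d' by move: d_gt0; rewrite d'E muln_gt0 => /andP[].
have [/dvdnP[c' c'E]|ndvd] := boolP (g %| c); last first.
  rewrite mul0n big1 // => j _; apply/eqP; rewrite eqb0.
  apply: contra ndvd => dvd.
  rewrite -(@dvdn_addr (u * j) g) ?(dvdn_trans _ dvd) ?dvdn_gcdr //.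
  by rewrite dvdn_mulr ?dvdn_gcdl.
rewrite mul1n (eq_bigr (fun j => nat_of_bool (d' %| u' * j + c'))) => [|j _].
  rewrite {1}d'E (mulnC d') mulnA sum_periodic => [|i].
    by rewrite count_coprime_congruence ?muln1.
  by rewrite mulnDr addnAC dvdn_addl ?dvdn_mull.
by rewrite {1}u'E {1}c'E {1}d'E mulnAC -mulnDl dvdn_pmul2r.
Qed.

(** Separates the two sides of a square that meet at the origin; the origin
    is counted on both. *)
Lemma split_square m (F : nat -> nat -> nat) :
  \sum_(0 <= l < m.+1) \sum_(0 <= j < m.+1) F j l + F 0 0 =
  \sum_(0 <= j < m.+1) F j 0 + \sum_(0 <= l < m.+1) F 0 l
   + \sum_(1 <= l < m.+1) \sum_(1 <= j < m.+1) F j l.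
Proof.
rewrite big_ltn //= (@big_ltn _ _ _ _ _ (fun l => F 0 l)) //.
under [X in _ + X + _]eq_big_nat => l _ do rewrite big_ltn //.
rewrite big_split /=; lia.
Qed.

Section TriangleCount.
Variables (d a b t : nat).
Hypotheses (d_gt0 : 0 < d) (t_gt0 : 0 < t) (gcd_abd : gcdn (gcdn a b) d = 1).
Hypothesis le_ab : a <= b.
Let n := t * d.
Let chi j l : nat := d %| a * j + b * l.

(** For fixed l the congruence in j is solvable only when (a,d) divides l,
    because (a,d) is prime to b; it has then t (a,d) solutions. *)
Lemma count_square :
  \sum_(0 <= l < n) \sum_(0 <= j < n) chi j l = t * n.
Proof.
have gcd_bg : gcdn b (gcdn a d) = 1 by rewrite gcdnA (gcdnC b).
have g_gt0 : 0 < gcdn a d by rewrite gcdn_gt0 d_gt0 orbT.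
have dE : d = (d %/ gcdn a d) * gcdn a d by rewrite divnK ?dvdn_gcdr.
transitivity (\sum_(0 <= l < t * (d %/ gcdn a d) * gcdn a d)
    (gcdn a d %| b * l + 0) * (t * gcdn a d)).
  rewrite -mulnA -dE; apply: eq_bigr => l _.
  by rewrite -count_congruence // addn0.
rewrite -big_distrl /= count_congruence // gcd_bg dvdn0 mul1n muln1 mulnCA.
by rewrite -[_ * _ * _ in LHS]mulnA -dE.
Qed.

Lemma count_horizontal : \sum_(0 <= j < n) chi j 0 = t * gcdn a d.
Proof.
rewrite /chi /n; under eq_bigr => j _ do rewrite muln0.
by rewrite count_congruence // dvdn0 mul1n.
Qed.

Lemma count_vertical : \sum_(0 <= l < n) chi 0 l = t * gcdn b d.
Proof.
rewrite /chi; under eq_bigr => j _ do rewrite muln0 add0n -[b * _]addn0.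
by rewrite /n count_congruence // dvdn0 mul1n.
Qed.

(** On the line j + l = td the condition becomes d | (b - a) l.  The
    successor accounts for one of the two end points, which both satisfy it. *)
Lemma count_diagonal :
  (\sum_(1 <= j < n) chi j (n - j)).+1 = t * gcdn (b - a) d.
Proof.
have n_gt0 : 0 < n by rewrite muln_gt0 t_gt0.
transitivity (\sum_(0 <= l < n) (d %| (b - a) * l + 0)); last first.
  by rewrite count_congruence // dvdn0 mul1n.
rewrite [RHS]big_ltn // muln0 dvdn0 add1n; congr _.+1.
rewrite [RHS]big_nat_rev /=; apply: eq_big_nat => j /andP[j_gt0 lt_jn].
rewrite /chi add1n subSS addn0 mulnBl.
have le1 : a * (n - j) <= b * (n - j) by rewrite leq_mul2r le_ab orbT.
rewrite -(@dvdn_addr (a * n) d (_ - _)); last by rewrite /n mulnA dvdn_mull.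
congr (nat_of_bool (d %| _)); rewrite -{2}(subnKC (ltnW lt_jn)) mulnDr -addnA.
by rewrite subnKC.
Qed.

Let O := \sum_(1 <= l < n) \sum_(1 <= j < n) (j + l < n) * chi j l.
Let H := \sum_(1 <= j < n) chi j (n - j).

Lemma sum_diagonal :
  \sum_(1 <= l < n) \sum_(1 <= j < n) (j + l == n) * chi j l = H.
Proof.
rewrite exchange_big; apply: eq_big_nat => j /andP[j_gt0 lt_jn].
rewrite (eq_bigr (fun l => if l == n - j then chi j l else 0)) => [|l _].
  rewrite -big_mkcond big_nat1_eq.
  by rewrite subn_gt0 lt_jn ltn_subrL j_gt0 (leq_trans _ lt_jn).
have -> : (j + l == n) = (l == n - j) by lia.
by case: ifP; rewrite ?mul1n.
Qed.

(** The half-turn (j, l) -> (n - j, n - l) preserves the lattice and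
    exchanges the two sides of the diagonal. *)
Lemma count_open_square :
  \sum_(1 <= l < n) \sum_(1 <= j < n) chi j l = 2 * O + H.
Proof.
have reflect_O : \sum_(1 <= l < n) \sum_(1 <= j < n) (n < j + l) * chi j l = O.
  rewrite big_nat_rev /=; apply: eq_big_nat => l /andP[l_gt0 lt_ln].
  rewrite big_nat_rev /=; apply: eq_big_nat => j /andP[j_gt0 lt_jn].
  rewrite !add1n !subSS; congr (nat_of_bool _ * nat_of_bool _); first by lia.
  apply: dvdn_add_eq; rewrite addnACA -!mulnDr !subnK 1?ltnW // -mulnDl /n.
  by rewrite mulnA dvdn_mull.
rewrite mul2n -addnn -{2}reflect_O -sum_diagonal /O -!big_split /=.
apply: eq_bigr => l _; rewrite -!big_split /=; apply: eq_bigr => j _.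
by case: (ltngtP (j + l) n); lia.
Qed.

Lemma count_triangle :
  2 * \sum_(0 <= l < n.+1) \sum_(0 <= j < n.+1)
        ((j + l <= n) && (d %| a * j + b * l)) =
  t * n + t * (gcdn a d + gcdn b d + gcdn (b - a) d) + 2.
Proof.
have n_gt0 : 0 < n by rewrite muln_gt0 t_gt0.
have dvd_n x : d %| x * n by rewrite /n mulnA dvdn_mull.
pose F j l := (j + l <= n) * chi j l.
have -> : \sum_(0 <= l < n.+1) \sum_(0 <= j < n.+1)
        ((j + l <= n) && (d %| a * j + b * l)) =
   \sum_(0 <= l < n.+1) \sum_(0 <= j < n.+1) F j l.
  by apply: eq_bigr => l _; apply: eq_bigr => j _; rewrite -mulnb.
have chi00 : chi 0 0 = 1 by rewrite /chi !muln0 dvdn0.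
have F00 : F 0 0 = 1 by rewrite /F chi00.
have Fa : \sum_(0 <= j < n.+1) F j 0 = t * gcdn a d + 1.
  rewrite big_nat_recr //= -count_horizontal /F addn0 leqnn /chi muln0 addn0 dvd_n.
  congr (_ + _); apply: eq_big_nat => j /andP[_ lt_jn].
  by rewrite addn0 (ltnW lt_jn) mul1n.
have Fb : \sum_(0 <= l < n.+1) F 0 l = t * gcdn b d + 1.
  rewrite big_nat_recr //= -count_vertical /F add0n leqnn /chi muln0 add0n dvd_n.
  congr (_ + _); apply: eq_big_nat => j /andP[_ lt_jn].
  by rewrite add0n (ltnW lt_jn) mul1n.
have Fin : \sum_(1 <= l < n.+1) \sum_(1 <= j < n.+1) F j l = O + H.
  have last_row : \sum_(1 <= j < n.+1) F j n = 0.
    by rewrite big_nat big1 // => j lt_j; rewrite /F; case: leqP => //; lia.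
  rewrite big_nat_recr //= last_row addn0 -sum_diagonal /O -big_split /=.
  apply: eq_big_nat => l lt_l.
  rewrite big_nat_recr //= /F [X in _ + X](_ : _ = 0) ?addn0; last first.
    by case: leqP => //; lia.
  rewrite -big_split /=; apply: eq_bigr => j _.
  by case: (ltngtP (j + l) n); lia.
(* The square gives 2 * O + H and the diagonal gives H, hence O + H, which is
   the closed triangle without its two sides. *)
have := split_square n F; rewrite F00 Fa Fb Fin.
have := split_square n.-1 chi.
rewrite prednK // chi00 count_square.
rewrite count_horizontal count_vertical count_open_square.
by have := count_diagonal; rewrite -/H; lia.
Qed.
End TriangleCount.

(** The exponents of x_1 and x_2 in the invariant monomials of degree n. *)
Definition triangle_points a b d n : {set 'I_n.+1 * 'I_n.+1} :=
  [set p : 'I_n.+1 * 'I_n.+1 | (p.1 + p.2 <= n) && (d %| a * p.1 + b * p.2)].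

(** The formula of Pick and Ehrhart for the triangle, whose normalized area is
    d and which has (a,d) + (b,d) + (b-a,d) lattice points on its boundary. *)
Lemma card_triangle_points d a b t :
    0 < d -> gcdn (gcdn a b) d = 1 -> a <= b ->
  2 * #|triangle_points a b d (t * d)| =
  t * (t * d) + t * (gcdn a d + gcdn b d + gcdn (b - a) d) + 2.
Proof.
move=> d_gt0 gcd_abd le_ab.
have -> : #|triangle_points a b d (t * d)| =
   \sum_(0 <= l < (t * d).+1) \sum_(0 <= j < (t * d).+1)
     ((j + l <= t * d) && (d %| a * j + b * l)).
  rewrite exchange_big big_mkord.
  under eq_bigr => j _ do rewrite big_mkord.
  rewrite pair_bigA -sum1_card big_mkcond; apply: eq_bigr => p _.
  by rewrite inE; case: ifP.
case: t => [|t]; last exact: count_triangle.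
by rewrite !big_nat1 !muln0 dvdn0.
Qed.

Local Open Scope ring_scope.

(** Since b = lam a' + mu d' and (a', d') = 1, the integers b and lam have the
    same gcd with d', and so have b - a and lam - (a,d).  Passing from d' to d
    does not change (b,d) and (b-a,d), because (a,d) is prime to b and b - a. *)
Lemma theta_boundary (d a b : nat) (lam mu : int) :
    (0 < d)%N -> (a <= b)%N -> gcdn (gcdn a b) d = 1%N ->
    b%:Z = lam * (a %/ gcdn a d)%N%:Z + mu * (d %/ gcdn a d)%N%:Z ->
  theta a d lam = (gcdn a d + gcdn b d + gcdn (b - a) d)%N%:Z.
Proof.
move=> d_gt0 le_ab gcd_abd; rewrite /theta.
set g := gcdn a d; set a' := (a %/ g)%N; set d' := (d %/ g)%N => b_eq.
have g_gt0 : (0 < g)%N by rewrite gcdn_gt0 d_gt0 orbT.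
have aE : a = (a' * g)%N by rewrite divnK ?dvdn_gcdl.
have dE : d = (d' * g)%N by rewrite divnK ?dvdn_gcdr.
have cop : coprimez a' d'.
  by rewrite coprimezE /coprime -(eqn_pmul2r g_gt0) mul1n muln_gcdl -aE -dE.
have gcdgb : coprime b g by rewrite /coprime gcdnA (gcdnC b) gcd_abd.
have reduce (c : nat) x y :
    coprime c g -> c%:Z = x * a'%:Z + y * d'%:Z -> gcdz x d' = gcdn c d.
  move=> cop_cg cE; have -> : gcdn c d = gcdn c d' by rewrite {1}dE Gauss_gcdl.
  rewrite -[RHS]/(gcdz c d') cE [RHS]gcdzC addrC gcdzMDl gcdzC.
  by rewrite Gauss_gcdzl // coprimez_sym.
rewrite (reduce b lam mu) // (reduce (b - a)%N (lam - g%:Z) mu) //.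
  rewrite /coprime gcdnC -(gcdnMDl a' g (b - a)) -aE subnKC // gcdnC.
  exact: gcdgb.
by rewrite -subzn // b_eq {1}aE PoszM mulrBl addrAC (mulrC g%:Z).
Qed.

(** * Dimension of a graded piece *)

(** A surjection from V onto a space of row vectors, with kernel the trace of
    W, both provides a basis of the quotient and turns any basis of it into an
    invertible matrix. *)
Lemma quot_dim_eq (k : fieldType) (L : lmodType k) (V W : L -> Prop) (n : nat)
    (phi : {linear L -> 'rV[k]_n}) :
    V 0 -> (forall c x y, V x -> V y -> V (c *: x + y)) ->
    (forall x, V x -> W x <-> phi x = 0) ->
    (forall r, exists2 x, V x & phi x = r) ->
  quot_dim V W = n.
Proof.
move=> V0 Vlin Wphi phi_onto.
have Vsum m (c : 'I_m -> k) (v : 'I_m -> L) :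
    (forall i, V (v i)) -> V (\sum_i c i *: v i).
  by move=> Vv; elim/big_rec: _ => // i x _ Vx; apply: Vlin.
have phi_sum m (c : 'I_m -> k) (v : 'I_m -> L) :
    phi (\sum_i c i *: v i) = (\row_i c i) *m \matrix_i phi (v i).
  rewrite linear_sum mulmx_sum_row; apply: eq_bigr => i _.
  by rewrite linearZ mxE rowK.
have Wsum m (c : 'I_m -> k) (v : 'I_m -> L) x : (forall i, V (v i)) -> V x ->
    W (x - \sum_i c i *: v i) <-> phi x = (\row_i c i) *m \matrix_i phi (v i).
  move=> Vv Vx; rewrite Wphi; last first.
    by rewrite addrC -scaleN1r; apply: Vlin => //; apply: Vsum.
  rewrite linearB /= phi_sum; split=> [/eqP|->]; last by rewrite subrr.
  by rewrite subr_eq0 => /eqP.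
rewrite /quot_dim; case: xgetP => [m _ [v [Vv v_free v_gen]]|no_basis].
  pose A := \matrix_i phi (v i).
  have : row_free A.
    apply: inj_row_free => u uA; apply/rowP=> i; rewrite [RHS]mxE.
    apply: (v_free (fun i => u 0 i)); apply/Wphi; first exact: Vsum.
    by rewrite phi_sum -[RHS]uA; congr (_ *m _); apply/rowP=> j; rewrite mxE.
  have : row_full A.
    rewrite -sub1mx; apply/row_subP=> i.
    have [x Vx phi_x] := phi_onto (row i 1%:M); rewrite -phi_x.
    have [c /Wsum-> //] := v_gen x Vx.
    exact: submxMl.
  rewrite /row_full /row_free => /eqP full /eqP free.
  exact: etrans (esym free) full.
have [v vP] : {v : 'I_n -> L & forall i, V (v i) /\ phi (v i) = delta_mx 0 i}.
  apply: (boolp.choice (P := fun i y => V y /\ phi y = delta_mx 0 i) _) => i.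
  by have [x Vx phix] := phi_onto (delta_mx 0 i); exists x.
have Vv i : V (v i) by case: (vP i).
have matE : \matrix_i phi (v i) = 1%:M.
  by apply/row_matrixP=> i; rewrite rowK row1; case: (vP i).
case: (no_basis n); exists v; split=> // [c|x Vx].
  move/Wphi => /(_ (Vsum _ _ _ Vv)); rewrite phi_sum matE mulmx1 => /rowP c0 i.
  by have := c0 i; rewrite !mxE.
exists (fun i => phi x 0 i); apply/Wsum => //; rewrite matE mulmx1.
by apply/rowP=> i; rewrite mxE.
Qed.

(** * Polynomials that vanish on the torus *)

Lemma digits_inj N n (u v : 'I_n -> nat) :
    (forall i, u i < N)%N -> (forall i, v i < N)%N ->
  (\sum_i u i * N ^ i = \sum_i v i * N ^ i)%N -> u =1 v.
Proof.
elim: n u v => [|n IHn] u v ltu ltv; first by move=> _ [].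
rewrite !big_ord_recl !expn0 !muln1.
have shift (w : 'I_n.+1 -> nat) :
   (\sum_(i < n) w (lift ord0 i) * N ^ lift ord0 i =
    (\sum_(i < n) w (lift ord0 i) * N ^ i) * N)%N.
  by rewrite big_distrl /=; apply: eq_bigr => i _; rewrite expnSr mulnA.
rewrite !shift => eq_uv.
have eq0 : u ord0 = v ord0.
  have := congr1 (modn^~ N) eq_uv.
  by rewrite -!(addnC (_ * N)%N) !modnMDl !modn_small.
have N_gt0 : (0 < N)%N by apply: leq_ltn_trans (ltu ord0).
move: eq_uv; rewrite eq0 => /addnI/eqP; rewrite eqn_pmul2r // => /eqP.
move/(IHn (fun i => u (lift ord0 i)) (fun i => v (lift ord0 i))) => eqS i.
by case: (unliftP ord0 i) => [j|] -> //; apply: eqS.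
Qed.

(** Kronecker substitution: at x_i = s^(N^i) with N above all the exponents,
    distinct monomials give distinct powers of s, so the polynomial in one
    variable s has the same coefficients.  It has all the positive integers as
    roots, hence is zero. *)
Lemma mpoly_vanish_eq0 (k : fieldType) n (p : {mpoly k[n]}) :
    [pchar k] =i pred0 ->
    (forall x : 'I_n -> k, (forall i, x i != 0) -> p.@[x] = 0) -> p = 0.
Proof.
move=> /pcharf0P natr_eq0 p_van; pose N := msize p.
pose code (m : 'X_{1..n}) := (\sum_i m i * N ^ i)%N.
have code_inj : {in msupp p &, injective code}.
  move=> m m' mp m'p eq_code; apply/mnmP; apply: digits_inj eq_code => i.
    rewrite (leq_ltn_trans _ (msize_mdeg_lt mp)) //.
    by rewrite mdegE (bigD1 i) //= leq_addr.
  rewrite (leq_ltn_trans _ (msize_mdeg_lt m'p)) //.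
  by rewrite mdegE (bigD1 i) //= leq_addr.
pose P : {poly k} := \sum_(m <- msupp p) p@_m *: 'X^(code m).
have P_eval s : P.[s] = p.@[fun i : 'I_n => s ^+ (N ^ i)].
  rewrite horner_sum mevalE; apply: eq_bigr => m _.
  rewrite hornerZ hornerXn; congr (_ * _).
  by rewrite -prodrXr; apply: eq_bigr => i _; rewrite -exprM mulnC.
have P0 : P = 0.
  apply/eqP; apply: contraT => P_neq0.
  pose rs : seq k := [seq i.+1%:R | i <- iota 0 (size P)].
  suff /(max_poly_roots P_neq0) : all (root P) rs.
    rewrite size_map size_iota ltnn; apply.
    rewrite map_inj_in_uniq ?iota_uniq // => i j _ _.
    wlog le_ij : i j / (i <= j)%N => [H|].
      by case/orP: (leq_total i j) => [/H//|/H le_eq /esym/le_eq].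
    move/eqP; rewrite eq_sym -subr_eq0 -natrB // natr_eq0 subSS
      subn_eq0 => le_ji.
    by apply/eqP; rewrite eqn_leq le_ij.
  apply/allP=> _ /mapP[i _ ->]; apply/eqP; rewrite P_eval p_van // => j.
  by rewrite expf_neq0 // natr_eq0.
apply/mpolyP=> m; rewrite mcoeff0.
have [mp|/memN_msupp_eq0 //] := boolP (m \in msupp p).
have := congr1 (fun Q : {poly k} => Q`_(code m)) P0.
rewrite coef0 coef_sum (bigD1_seq m) ?msupp_uniq //= coefZ coefXn eqxx mulr1.
rewrite big1_seq ?addr0 => [|m' /andP[ne_m m'p]] //.
rewrite coefZ coefXn; case: eqP => [/code_inj eq_m|]; last by rewrite mulr0.
by rewrite eq_m ?eqxx in ne_m.
Qed.

Lemma meval_homog_scale (R : comNzRingType) n t (f : {mpoly R[n]}) c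
    (y : 'I_n -> R) :
  f \is t.-homog -> f.@[fun i => c * y i] = c ^+ t * f.@[y].
Proof.
move=> /dhomogP f_hom; rewrite !mevalE big_distrr /=.
rewrite big_seq [RHS]big_seq; apply: eq_bigr => m mf.
rewrite mulrCA; congr (_ * _).
rewrite -(f_hom m mf) /= mdegE -prodrXr -big_split.
by apply: eq_bigr => i _; rewrite exprMn.
Qed.

(** Vanishing on X is stable under sums of multiples; conversely a vanishing
    form is one of the generators. *)
Lemma homog_idealP (k : fieldType) n (X : ('I_n -> k) -> Prop) t f :
  f \is t.-homog -> homog_ideal X f <-> vanishes_on X f.
Proof.
move=> f_hom; split=> [[r [g [h [hX ->]]]] x Xx|f_van].
  rewrite raddf_sum /= big1 // => i _; rewrite mevalM.
  by have [_ ->] := hX i; rewrite ?mulr0.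
exists 1%N, (fun=> 1), (fun=> f); split; last by rewrite big_ord1 mul1r.
by move=> _; split; first by exists t.
Qed.

(** * Monomial substitutions *)

Section MonomialMap.
Variables (R : comNzRingType) (r n : nat) (M : 'I_r -> 'X_{1..n}).

Definition mnm_image (m : 'X_{1..r}) : 'X_{1..n} := (\sum_i M i *+ m i)%MM.

Definition monomial_subst : {mpoly R[r]} -> {mpoly R[n]} :=
  comp_mpoly [tuple 'X_[M i] | i < r].

Lemma monomial_subst_is_linear : linear monomial_subst.
Proof. by move=> c f g; rewrite /monomial_subst comp_mpolyD comp_mpolyZ. Qed.

HB.instance Definition _ := GRing.isLinear.Build R {mpoly R[r]} {mpoly R[n]} _
  monomial_subst monomial_subst_is_linear.

Lemma monomial_substX m : monomial_subst 'X_[m] = 'X_[mnm_image m].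
Proof.
rewrite /monomial_subst comp_mpolyX -mprodXnE.
by apply: eq_bigr => i _; rewrite tnth_mktuple.
Qed.

Lemma meval_monomial_subst f x :
  (monomial_subst f).@[x] = f.@[fun i => 'X_[M i].@[x]].
Proof.
rewrite comp_mpoly_meval; apply: meval_eq => i.
by rewrite tnth_mktuple.
Qed.

Lemma mcoeff_monomial_subst f v :
  (monomial_subst f)@_v = \sum_(m <- msupp f) f@_m * (mnm_image m == v)%:R.
Proof.
have -> : monomial_subst f = \sum_(m <- msupp f) f@_m *: 'X_[mnm_image m].
  rewrite [in LHS](mpolyE f) linear_sum; apply: eq_bigr => m _.
  by rewrite linearZ /= monomial_substX.
by rewrite raddf_sum; apply: eq_bigr => m _; rewrite /= mcoeffZ mcoeffX.
Qed.

Lemma mnm_imageD m1 m2 : mnm_image (m1 + m2) = (mnm_image m1 + mnm_image m2)%MM.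
Proof.
apply/mnmP=> j; rewrite mnmDE !mnm_sumE -big_split; apply: eq_bigr => i _.
by rewrite !mulmnE mnmDE mulnDr.
Qed.

Lemma mnm_image1 i : mnm_image U_(i) = M i.
Proof.
rewrite /mnm_image (bigD1 i) //= mnm1E eqxx mulm1n big1 ?addm0 // => j ne_ji.
by rewrite mnm1E eq_sym (negbTE ne_ji) mulm0n.
Qed.

Lemma mdeg_mnm_image d m :
  (forall i, mdeg (M i) = d) -> mdeg (mnm_image m) = (mdeg m * d)%N.
Proof.
move=> degM; rewrite mdeg_sum [mdeg m]mdegE big_distrl; apply: eq_bigr => i _.
by rewrite mdegMn degM mulnC.
Qed.

End MonomialMap.

(** * The Hilbert function of the GT-surface *)

Section InvariantMonomials.
Variables (k : fieldType) (a b d : nat) (e : k).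
Hypotheses (d_gt0 : (0 < d)%N) (e_prim : d.-primitive_root e).

(** The generator of Lambda acts on the monomial m by e to this power. *)
Definition weight (m : 'X_{1..3}) : nat := a * m (inord 1) + b * m (inord 2).

Lemma Lambda_gen_exp j :
  Lambda_gen e a b ^+ j = diag_mx (\row_i [:: 1; e ^+ a; e ^+ b]`_i ^+ j).
Proof.
elim: j => [|j IHj]; first by apply/matrixP=> i l; rewrite !mxE.
rewrite exprS IHj -[_ * _]/(_ *m _) /Lambda_gen mulmx_diag; congr diag_mx.
by apply/rowP=> i; rewrite !mxE exprS.
Qed.

Lemma lin_substX j (m : 'X_{1..3}) :
  lin_subst (Lambda_gen e a b ^+ j) 'X_[m] = e ^+ (j * weight m) *: 'X_[m].
Proof.
rewrite /lin_subst comp_mpolyX Lambda_gen_exp.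
pose D (i : 'I_3) := [:: 1; e ^+ a; e ^+ b]`_i ^+ j.
rewrite (eq_bigr (fun i => D i ^+ m i *: 'X_i ^+ m i)) => [|i _]; last first.
  rewrite tnth_mktuple (bigD1 i) //= big1 => [|l ne_li].
    by rewrite addr0 !mxE eqxx mulr1n exprZn.
  by rewrite !mxE eq_sym (negbTE ne_li) mulr0n scale0r.
rewrite scaler_prod -mpolyXE_id; congr (_ *: _).
rewrite !big_ord_recl big_ord0 /D /= !expr1n mul1r mulr1 -!exprM -exprD.
congr (e ^+ _); rewrite /weight.
have -> : inord 1 = lift ord0 (ord0 : 'I_2) by apply/val_inj; rewrite /= inordK.
have -> : inord 2 = lift ord0 (lift ord0 (ord0 : 'I_1)).
  by apply/val_inj; rewrite /= inordK.
by rewrite mulnDr; congr (_ + _)%N; rewrite mulnCA mulnA.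
Qed.

Lemma mem_inv_monomials m :
  (m \in inv_monomials e a b d) = (mdeg m == d) && (d %| weight m)%N.
Proof.
rewrite mem_filter -andbA; case: eqP => //= deg_m.
have -> : m \in [seq bmnm m | m <- enum {: 'X_{1..3 < d.+1}}].
  have lt_m : (mdeg m < d.+1)%N by rewrite deg_m.
  by apply/mapP; exists (BMultinom lt_m); rewrite ?mem_enum.
rewrite andbT; apply/allP/idP => [inv_m|dvd_m _ /mapP[j _ ->]]; last first.
  rewrite lin_substX.
  have -> : e ^+ (j * weight m) = 1; last by rewrite scale1r.
  by apply/eqP; rewrite -(prim_order_dvd e_prim) dvdn_mull.
(* The exponent is 1 %% d because for d = 1 the listed powers stop at 0. *)
have := inv_m (Lambda_gen e a b ^+ (1 %% d)); rewrite map_f.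
  rewrite lin_substX => /(_ isT)/eqP/(congr1 (mcoeff m)).
  rewrite mcoeffZ mcoeffX eqxx mulr1 => /eqP; rewrite -(prim_order_dvd e_prim).
  by rewrite /dvdn modnMml mul1n.
by rewrite mem_iota /= add0n ltn_pmod.
Qed.

Definition inv_monomial (i : 'I_(GT_mu e a b d)) : 'X_{1..3} :=
  tnth (in_tuple (inv_monomials e a b d)) i.

Lemma inv_monomialP i :
  mdeg (inv_monomial i) = d /\ (d %| weight (inv_monomial i))%N.
Proof.
have := mem_tnth i (in_tuple (inv_monomials e a b d)).
by rewrite mem_inv_monomials => /andP[/eqP].
Qed.

Lemma inv_monomial_surj m : mdeg m = d -> (d %| weight m)%N ->
  exists i, inv_monomial i = m.
Proof.
move=> deg_m dvd_m.
have /tnthP[i ->] : m \in in_tuple (inv_monomials e a b d).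
  by rewrite mem_inv_monomials deg_m eqxx.
by exists i.
Qed.

Lemma weightD m1 m2 : weight (m1 + m2) = (weight m1 + weight m2)%N.
Proof. by rewrite /weight !mnmDE !mulnDr addnACA. Qed.

Lemma weight_mnm_image m : (d %| weight (mnm_image inv_monomial m))%N.
Proof.
rewrite /mnm_image; elim/big_rec: _ => [|i v _ dvd_v].
  by rewrite /weight !mnm0E !muln0 dvdn0.
rewrite weightD dvdn_add //; elim: (m i) => [|j IHj].
  by rewrite mulm0n /weight !mnm0E !muln0 dvdn0.
by rewrite mulmS weightD dvdn_add //; case: (inv_monomialP i).
Qed.

Definition mnm3 (i j l : nat) : 'X_{1..3} := [multinom [tuple i; j; l]].

Lemma mdeg3 (m : 'X_{1..3}) : mdeg m = (m ord0 + m (inord 1) + m (inord 2))%N.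
Proof.
rewrite mdegE !big_ord_recl big_ord0 addn0 addnA; congr (_ + m _ + m _)%N.
  by apply/val_inj; rewrite /= inordK.
by apply/val_inj; rewrite /= inordK.
Qed.

Lemma mnm3E i j l :
  [/\ mnm3 i j l ord0 = i, mnm3 i j l (inord 1) = j & mnm3 i j l (inord 2) = l].
Proof. by rewrite /mnm3 !multinomE !(tnth_nth 0%N) /= !inordK. Qed.

Lemma mnm3_eq (m m' : 'X_{1..3}) :
    m ord0 = m' ord0 -> m (inord 1) = m' (inord 1) ->
  m (inord 2) = m' (inord 2) -> m = m'.
Proof.
move=> eq0 eq1 eq2; apply/mnmP; case=> [[|[|[|//]]] lt_i].
- by rewrite (_ : Ordinal _ = ord0) //; apply/val_inj.
- by rewrite (_ : Ordinal _ = inord 1) //; apply/val_inj; rewrite /= inordK.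
- by rewrite (_ : Ordinal _ = inord 2) //; apply/val_inj; rewrite /= inordK.
Qed.

(** The triangle is normal: invariant monomials of degree td are products of
    t invariant monomials of degree d. *)
Lemma invariant_factors t v : mdeg v = (t * d)%N -> (d %| weight v)%N ->
  exists2 m, mdeg m = t & mnm_image inv_monomial m = v.
Proof.
elim: t v => [|t IHt] v deg_v dvd_v.
  exists 0%MM; first by rewrite mdeg0.
  move/eqP: deg_v; rewrite mdeg_eq0 => /eqP->.
  by apply: big1 => i _; rewrite mnm0E mulm0n.
have [i' [j' [l' [[le_i le_j le_l] sum' dvd']]]] :=
  triangle_split d_gt0 (etrans (esym (mdeg3 v)) deg_v) dvd_v.
pose w := mnm3 i' j' l'; have [w0 w1 w2] := mnm3E i' j' l'.
have [i iE] : exists i, inv_monomial i = w.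
  by apply: inv_monomial_surj; rewrite ?mdeg3 /weight ?w0 ?w1 ?w2.
have vE : v = (w + (v - w))%MM.
  by apply: mnm3_eq; rewrite mnmDE mnmBE ?w0 ?w1 ?w2 subnKC.
have [m deg_m mE] : exists2 m, mdeg m = t &
    mnm_image inv_monomial m = (v - w)%MM.
  apply: IHt; last first.
    by move: dvd_v; rewrite {1}vE weightD dvdn_addr // /weight w1 w2.
  by move: deg_v; rewrite {1}vE mdegD mdeg3 w0 w1 w2 sum' mulSn => /addnI.
exists (U_(i) + m)%MM; first by rewrite mdegD mdeg1 deg_m.
by rewrite mnm_imageD mnm_image1 iE mE -vE.
Qed.

(** The torus maps into X_d: there no monomial vanishes, so the image point
    is defined as soon as some invariant monomial exists, for example x_0^d. *)
Lemma vanishes_on_GT_surface t (f : {mpoly k[GT_mu e a b d]}) :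
    [pchar k] =i pred0 -> f \is t.-homog ->
  vanishes_on (GT_surface e a b d) f <-> monomial_subst inv_monomial f = 0.
Proof.
move=> char0 f_hom.
have eval_f x : f.@[GT_map x] = (monomial_subst inv_monomial f).@[x].
  by rewrite meval_monomial_subst.
split=> [f_van|f0 y [_ [x _ [c _ yE]]]]; last first.
  rewrite (meval_eq _ yE) (meval_homog_scale _ _ f_hom).
  by rewrite eval_f f0 meval0 mulr0.
apply: mpoly_vanish_eq0 => // x x_neq0; rewrite -eval_f.
have mon_neq0 m : 'X_[m].@[x] != 0.
  by rewrite mevalX; apply/prodf_neq0 => i _; rewrite expf_neq0.
have [i iE] : exists i, inv_monomial i = mnm3 d 0 0.
  have [w0 w1 w2] := mnm3E d 0 0.
  by apply: inv_monomial_surj; rewrite ?mdeg3 /weight ?w0 ?w1 ?w2 ?muln0 ?addn0.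
apply: f_van; split; first by exists i; apply: mon_neq0.
exists x; first by exists ord0.
by exists 1; rewrite ?oner_neq0 // => j; rewrite mul1r.
Qed.

(** A form of degree t is determined modulo I(X_d) by the coefficients, at the
    invariant monomials of degree td, of its image under the substitution; by
    normality these coefficients are arbitrary. *)
Lemma hilbert_fun_GT_surface t : [pchar k] =i pred0 ->
  hilbert_fun (GT_surface e a b d) t =
  #|triangle_points a b d (t * d)|.
Proof.
move=> char0; set B := triangle_points _ _ _ _.
pose mon (p : 'I_(t * d).+1 * 'I_(t * d).+1) :=
  mnm3 (t * d - p.1 - p.2) p.1 p.2.
have mon_inj : injective mon.
  move=> p q eq_pq; have [_ p1 p2] := mnm3E (t * d - p.1 - p.2) p.1 p.2.
  have [_ q1 q2] := mnm3E (t * d - q.1 - q.2) q.1 q.2.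
  move: p1 p2; rewrite -/(mon p) eq_pq q1 q2 {eq_pq q1 q2}.
  by case: p q => [i j] [i' j'] /= /val_inj-> /val_inj->.
have mon_inv p : p \in B -> mdeg (mon p) = (t * d)%N /\ (d %| weight (mon p))%N.
  rewrite inE => /andP[le_p dvd_p].
  have [p0 p1 p2] := mnm3E (t * d - p.1 - p.2) p.1 p.2.
  by rewrite mdeg3 /weight p0 p1 p2; split; rewrite // -subnDA -addnA subnK.
have mon_onto v : mdeg v = (t * d)%N -> (d %| weight v)%N ->
    exists2 p, p \in B & mon p = v.
  move=> deg_v dvd_v; have := deg_v; rewrite mdeg3 => sum_v.
  exists (inord (v (inord 1)), inord (v (inord 2))).
    by rewrite inE /= !inordK ?dvd_v ?andbT; lia.
  have [v0 v1 v2] :=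
    mnm3E (t * d - v (inord 1) - v (inord 2)) (v (inord 1)) (v (inord 2)).
  rewrite /mon /= !inordK; [|lia|lia].
  by apply: mnm3_eq; rewrite ?v0 ?v1 ?v2 //; lia.
pose phi (f : {mpoly k[GT_mu e a b d]}) : 'rV_#|B| :=
  \row_i (monomial_subst inv_monomial f)@_(mon (enum_val i)).
have phi_lin : linear phi.
  by move=> c f g; apply/rowP=> i; rewrite !mxE linearP mcoeffD mcoeffZ.
pose phiL := HB.pack_for {linear {mpoly k[GT_mu e a b d]} -> 'rV[k]_#|B|} phi
  (GRing.isLinear.Build _ _ _ _ _ phi_lin).
apply: (quot_dim_eq (phi := phiL)) => [|c f g f_hom g_hom|f f_hom|r].
- exact: dhomog0.
- by apply: dhomogD => //; apply: dhomogZ.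
- rewrite (homog_idealP _ f_hom) (vanishes_on_GT_surface char0 f_hom).
  split=> [f0|/rowP f0]; first by apply/rowP=> i; rewrite !mxE f0 mcoeff0.
  apply/mpolyP=> v; rewrite mcoeff0.
  have [[deg_v dvd_v]|v_ninv] :=
    pselect (mdeg v = (t * d)%N /\ (d %| weight v)%N).
    have [p Bp <-] := mon_onto v deg_v dvd_v.
    by have := f0 (enum_rank_in Bp p); rewrite !mxE enum_rankK_in.
  rewrite mcoeff_monomial_subst big1_seq // => m /andP[_ mf].
  case: eqP => [mE|]; last by rewrite mulr0.
  case: v_ninv; rewrite -mE weight_mnm_image (mdeg_mnm_image (d := d)).
    by rewrite (dhomog_mf f_hom mf).
  by move=> i; case: (inv_monomialP i).
- have [m mP] : {m : 'I_#|B| -> 'X_{1..GT_mu e a b d} & forall i,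
      mdeg (m i) = t /\ mnm_image inv_monomial (m i) = mon (enum_val i)}.
    apply: (boolp.choice (P := fun i m => mdeg m = t /\
      mnm_image inv_monomial m = mon (enum_val i)) _) => i.
    have [deg_i dvd_i] := mon_inv _ (enum_valP i).
    by have [m degm mE] := invariant_factors deg_i dvd_i; exists m.
  exists (\sum_i r 0 i *: 'X_[m i]).
    apply: rpred_sum => i _.
    by rewrite dhomogZ // dhomogX; case: (mP i) => /= ->.
  have -> : phiL (\sum_i r 0 i *: 'X_[m i]) = \sum_i r 0 i *: phi 'X_[m i].
    by rewrite linear_sum; apply: eq_bigr => i _; rewrite linearZ.
  rewrite [RHS]row_sum_delta; apply: eq_bigr => i _; congr (_ *: _).
  apply/rowP=> j; rewrite !mxE monomial_substX mcoeffX.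
  case: (mP i) => _ ->.
  by rewrite (inj_eq mon_inj) (inj_eq enum_val_inj) eq_sym.
Qed.

End InvariantMonomials.

(** * The Hilbert series *)

Lemma coef_one_subX3 (F : fieldType) i :
  ((1 - 'X) ^+ 3 : {poly F})`_i = [:: 1; -3; 3; -1]`_i.
Proof.
have -> : (1 - 'X) ^+ 3 = Poly [:: 1; -3; 3; -1] :> {poly F}.
  rewrite /= !cons_poly_def polyC0 -!(polyCN, polyC1) !polyC_natr; ring.
by rewrite coef_Poly.
Qed.

(** The recurrence given by (1 - z)^3 kills quadratic polynomials from the
    coefficient of z^3 on; the numerator collects the first three. *)
Lemma quadratic_fps (F : fieldType) (u v : F) (f : nat -> F) :
    (forall t, f t = u * t%:R ^+ 2 + v * t%:R + 1) ->
  fps_is_frac f ((u - v + 1) *: 'X ^+ 2 + (u + v - 2) *: 'X + 1)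
    ((1 - 'X) ^+ 3).
Proof.
move=> fE; split=> [|n]; first by rewrite coef_one_subX3 oner_neq0.
rewrite /fps_mul /fps_of_poly !coefD !coefZ coefXn coefX coef1.
under eq_bigr => i _ do rewrite coef_one_subX3.
case: n => [|[|[|n]]]; rewrite /= ?big_ord_recl ?big_ord0 /= !fE /bump /=.
- by rewrite !subn0; ring.
- by rewrite !add1n !subSS !subn0; ring.
- by rewrite !add1n !subSS !subn0; ring.
rewrite big1 => [|i _]; last by rewrite nth_nil mul0r.
by rewrite !add1n !subSS !subn0; ring.
Qed.

Unset Implicit Arguments.
Set Strict Implicit.

Theorem theorem4p12 (k : closedFieldType) (char0 : [pchar k] =i pred0)
    (d a b : nat) (e : k) (lam mu : int)
    (d_ge3 : (3 <= d)%N) (a_gt0 : (0 < a)%N) (a_lt_b : (a < b)%N)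
    (b_lt_d : (b < d)%N) (gcd_abd : gcdn (gcdn a b) d = 1%N)
    (e_prim : d.-primitive_root e)
    (lam_gt0 : 0 < lam) (lam_le : lam <= (d %/ gcdn a d)%N%:Z)
    (b_eq : b%:Z = lam * (a %/ gcdn a d)%N%:Z + mu * (d %/ gcdn a d)%N%:Z) :
  (forall t : nat,
     (hilbert_fun (GT_surface e a b d) t)%:R =
       d%:R / 2 * t%:R ^+ 2 + (theta a d lam)%:~R / 2 * t%:R + 1 :> rat)
  /\
  fps_is_frac (hilbert_series (GT_surface e a b d))
    (((d%:R - (theta a d lam)%:~R + 2) / 2) *: 'X ^+ 2
       + ((d%:R + (theta a d lam)%:~R - 4) / 2) *: 'X + 1)
    ((1 - 'X) ^+ 3).
Proof.
have d_gt0 : (0 < d)%N by apply: leq_trans d_ge3.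
have le_ab := ltnW a_lt_b.
have HF t : (hilbert_fun (GT_surface e a b d) t)%:R =
    d%:R / 2 * t%:R ^+ 2 + (theta a d lam)%:~R / 2 * t%:R + 1 :> rat.
  rewrite (theta_boundary d_gt0 le_ab gcd_abd b_eq).
  have := card_triangle_points t d_gt0 gcd_abd le_ab.
  rewrite -(hilbert_fun_GT_surface a b d_gt0 e_prim t char0).
  move=> /(congr1 (fun n : nat => n%:R : rat)).
  rewrite -pmulrn !natrD !natrM !natrD => HFE.
  lra.
split=> //.
have -> : (d%:R - (theta a d lam)%:~R + 2) / 2 =
  d%:R / 2 - (theta a d lam)%:~R / 2 + 1 :> rat by field.
have -> : (d%:R + (theta a d lam)%:~R - 4) / 2 =
  d%:R / 2 + (theta a d lam)%:~R / 2 - 2 :> rat by field.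
exact: quadratic_fps.
Qed.
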